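(* The map $\mathbb{S}^1\times\mathbb{R}\ni(e,s)\mapsto c_{e,s}$, where $c_{e,s}(t)=sie+et$ $(t\in\mathbb{R})$, is a one-to-one correspondence between $\mathbb{S}^1\times\mathbb{R}$ and the set of oriented lines in the Euclidean plane $\mathbb{E}^2=\mathbb{C}$. Moreover, the map $$f:\mathbb{P}^1_{\mathbb{D}}\to\mathbb{S}^1\times\mathbb{R},\qquad f([e+k\varepsilon\, ie])=(e^2,2k)\qquad (e\in\mathbb{C},\ |e|=1,\ k\in\mathbb{R}),$$ is a well-defined diffeomorphism and it is an isometry up to rescaling the metrics: $f^*g_{T\mathbb{S}^1}=4\,g_{\mathbb{P}^1_{\mathbb{D}}}$. Consequently $\mathbb{P}^1_{\mathbb{D}}$ is (via $[p]\mapsto c_{f([p])}$) the space of all oriented lines of the Euclidean plane.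
   Context: $\mathbb{D}=\mathbb{R}+\varepsilon\mathbb{R}$, $\varepsilon^2=0$, denotes the dual numbers with involution $(x+\varepsilon y)^*=x-\varepsilon y$, and $\mathbb{D}^\times=\{a+\varepsilon b: a\neq0\}$ is its group of units. Let $V=\mathbb{D}^2$, identified with $\mathbb{C}+\varepsilon\,\mathbb{C}$ via $\mathbb{R}^2=\mathbb{C}$ (so a vector is $x+\varepsilon y$ with $x,y\in\mathbb{C}=\mathbb{R}^2$), with $\mathbb{D}$-valued Hermitian form $\langle u,v\rangle=u_1v_1^*+u_2v_2^*$. A vector $u\in V$ is good if $u_1\mathbb{D}+u_2\mathbb{D}=\mathbb{D}$; $V^\bullet$ is the set of good vectors, and $\mathbb{P}^1_{\mathbb{D}}:=V^\bullet/\mathbb{D}^\times$ is a smooth surface; $[p]$ is the class of $p$. For every $p\in V^\bullet$ one has $\langle p,p\rangle\in\mathbb{R}\setminus\{0\}$. The tangent space at $[p]$ is identified with the space of $\mathbb{D}$-linear maps $\phi:\mathbb{D}p\to p^\perp$, where $p^\perp=\{v\in V:\langle v,p\rangle=0\}$ ($\phi$ is the tangent vector at $\epsilon=0$ of the curve $\epsilon\mapsto[p+\epsilon\phi(p)]$, with $\epsilon$ a real parameter), and the (degenerate) metric is $g_{\mathbb{P}^1_{\mathbb{D}}}(\phi,\psi)=\mathrm{Re}\,\frac{\langle\phi(p),\psi(p)\rangle}{\langle p,p\rangle}$ with $\mathrm{Re}\,u=(u+u^* )/2$. $\mathbb{S}^1$ is the circle of unit complex numbers. $\mathbb{S}^1\times\mathbb{R}$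 is identified with $T\mathbb{S}^1$ via $(e,s)\mapsto(e,sie)$, and carries the (degenerate) metric $g_{T\mathbb{S}^1}((u_1,s_1),(u_2,s_2))=\mathrm{Re}(u_1\overline{u_2})$, where tangent vectors of $\mathbb{S}^1\times\mathbb{R}\subset\mathbb{C}\times\mathbb{R}$ are written as elements of $\mathbb{C}\times\mathbb{R}$. *)

(* Defs.v *)
From HB Require Import structures.
From mathcomp Require Import all_boot all_order all_algebra generic_quotient.
From mathcomp Require Import all_classical all_reals all_analysis.
From mathcomp Require Import complex.
From mathcomp Require Import ring.

Set Implicit Arguments.
Unset Strict Implicit.
Unset Printing Implicit Defensive.

Import Order.TTheory GRing.Theory Num.Theory.
Import numFieldNormedType.Exports.

Local Open Scope classical_set_scope.
Local Open Scope ring_scope.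

(* [Rcomplex R] is the complex plane as a real vector space with the real-valued
   norm [`|z|]; here it receives the topology of that norm. *)
Section ComplexPlane.
Variable R : realType.

Lemma Rcomplex_normZ (l : R) (z : Rcomplex R) : `|l *: z| = `|l| * `|z|.
Proof.
case: z => a b.
rewrite /Num.norm /= /Normc.normc /=.
by rewrite !exprMn -mulrDr sqrtrM ?sqr_ge0// sqrtr_sqr.
Qed.

HB.instance Definition _ :=
  PseudoMetric.copy (Rcomplex R) (pseudoMetric_normed (Rcomplex R)).
HB.instance Definition _ := isPointed.Build (Rcomplex R) 0.
HB.instance Definition _ :=
  NormedZmod_PseudoMetric_eq.Build R (Rcomplex R) erefl.
HB.instance Definition _ :=
  PseudoMetricNormedZmod_Lmodule_isNormedModule.Build R (Rcomplex R)
    Rcomplex_normZ.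

End ComplexPlane.

Definition ii {R : realType} : Rcomplex R := Complex 0 1.

(* The pair [(a, b)] stands for a + eps b.  The alias keeps the real normed
   module structure of [R * R] but not its componentwise product. *)
Definition dual (R : realType) : Type := (R * R)%type.

Section Dual.
Variable R : realType.

HB.instance Definition _ := NormedModule.copy (dual R) (R * R)%type.

Implicit Types u : dual R.

Definition dual_one : dual R := (1, 0).
Definition dual_mul u (v : dual R) : dual R := (u.1 * v.1, u.1 * v.2 + u.2 * v.1).
Definition dual_unit : pred (dual R) := fun u => u.1 != 0.
Definition dual_inv u : dual R :=
  if dual_unit u then (u.1^-1, - u.2 / u.1 ^+ 2) else u.

Fact dual_mulA : associative dual_mul.
Proof.
by move=> [a b] [c d] [e f]; congr pair; rewrite /=; ring.
Qed.
Fact dual_mulC : commutative dual_mul.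
Proof. by move=> [a b] [c d]; congr pair; rewrite /=; ring. Qed.
Fact dual_mul1 : left_id dual_one dual_mul.
Proof. by move=> [a b]; congr pair; rewrite /=; ring. Qed.
Fact dual_mulDl : left_distributive dual_mul +%R.
Proof. by move=> [a b] [c d] [e f]; congr pair; rewrite /=; ring. Qed.
Fact dual_one_neq0 : dual_one != 0.
Proof. by apply/eqP => -[/eqP]; rewrite oner_eq0. Qed.

HB.instance Definition _ := GRing.Zmodule_isComNzRing.Build (dual R)
  dual_mulA dual_mulC dual_mul1 dual_mulDl dual_one_neq0.

Fact dual_mulV : {in dual_unit, left_inverse 1 dual_inv *%R}.
Proof.
move=> u; rewrite unfold_in => u0; rewrite /dual_inv /dual_unit u0.
by congr pair => /=; field.
Qed.
Fact dual_unitP u (v : dual R) : v * u = 1 -> dual_unit u.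
Proof.
case=> /= h _; apply/eqP => u0; move: h; rewrite u0 mulr0 => /eqP.
by rewrite eq_sym oner_eq0.
Qed.
Fact dual_inv_out : {in predC dual_unit, dual_inv =1 id}.
Proof. by move=> u /negbTE h; rewrite /dual_inv (h : dual_unit u = false). Qed.

HB.instance Definition _ := GRing.ComNzRing_hasMulInverse.Build (dual R)
  dual_mulV dual_unitP dual_inv_out.

Lemma dual_unitE u : (u \is a GRing.unit) = (u.1 != 0).
Proof. by []. Qed.

Definition dual_real (x : R) : dual R := (x, 0).
Definition dual_conj u : dual R := (u.1, - u.2).

(* (u + u^* ) / 2 lies in R; [.1] reads it off as a real number. *)
Definition dual_Re u : R := (2^-1 *: (u + dual_conj u)).1.

(* D^2, as a D-module (the action on itself being that of [_^o]). *)
Definition dvec : Type := ((dual R)^o * (dual R)^o)%type.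
HB.instance Definition _ := GRing.Lmodule.on dvec.
HB.instance Definition _ := Choice.on dvec.

(* x + eps y with x, y in C = R^2. *)
Definition of_complex (x y : Rcomplex R) : dvec :=
  ((complex.Re x, complex.Re y), (complex.Im x, complex.Im y)).

Definition hform (p q : dvec) : dual R :=
  p.1 * dual_conj q.1 + p.2 * dual_conj q.2.

Definition good (p : dvec) : Prop :=
  [set d : dual R | exists a b : dual R, d = p.1 * a + p.2 * b] = setT.

Lemma goodP (p : dvec) :
  good p <-> (p.1 : dual R) \is a GRing.unit \/ (p.2 : dual R) \is a GRing.unit.
Proof.
split=> [gp|].
  have : [set: dual R] 1 by [].
  rewrite -gp => -[a [b [e _]]].
  rewrite !dual_unitE; case: eqVneq => [p10|]; last by left.
  right; apply/eqP => p20; move: e; rewrite /= p10 p20 !mul0r addr0 => /eqP.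
  by rewrite oner_eq0.
move=> up; apply/seteqP; split => // d _; case: up => up.
  by exists ((p.1 : dual R)^-1 * d), 0; rewrite mulr0 addr0 mulVKr.
by exists 0, ((p.2 : dual R)^-1 * d); rewrite mulr0 add0r mulVKr.
Qed.

Definition good_vec : Type := {p : dvec | `[< good p >]}.
HB.instance Definition _ := Choice.on good_vec.

Definition proportional (p q : good_vec) : bool :=
  `[< exists2 l : dual R, l \is a GRing.unit & val q = l *: val p >].

Fact proportional_refl : reflexive proportional.
Proof. by move=> p; apply/asboolP; exists 1; rewrite ?unitr1// scale1r. Qed.
Fact proportional_sym : symmetric proportional.
Proof.
suff h p q : proportional p q -> proportional q p.
  by move=> p q; apply/idP/idP; exact: h.
move=> /asboolP[l ul e]; apply/asboolP; exists l^-1; rewrite ?unitrV//.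
by rewrite e scalerA mulVr// scale1r.
Qed.
Fact proportional_trans : transitive proportional.
Proof.
move=> q p r /asboolP[l ul e] /asboolP[m um e']; apply/asboolP.
by exists (m * l); rewrite ?unitrM ?ul ?um// e' e scalerA.
Qed.

Canonical proportional_equiv := EquivRel proportional
  proportional_refl proportional_sym proportional_trans.

Definition P1 : Type := {eq_quot proportional_equiv}%qT.

Fact good_base : `[< good ((1, 0) : dvec) >].
Proof. by apply/asboolP/goodP; left; exact: unitr1. Qed.

(* [p]; total by sending the vectors that are not good to a junk point. *)
Definition cls (p : dvec) : P1 :=
  \pi_P1%qT (insubd (Sub ((1, 0) : dvec) good_base : good_vec) p).

Lemma cls_eqP (p q : dvec) : good p -> good q ->
  cls p = cls q <-> exists2 l : dual R, l \is a GRing.unit & q = l *: p.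
Proof.
move=> /asboolP gp /asboolP gq; rewrite /cls; split.
  move=> /eqmodP /asboolP[l ul]; rewrite !val_insubd gp gq.
  by exists l.
by case=> l ul e; apply/eqmodP/asboolP; exists l; rewrite // !val_insubd gp gq.
Qed.

Lemma cls_surj (P : P1) : exists2 p, good p & P = cls p.
Proof.
elim/quotW: P => -[p gp]; exists p; first exact/asboolP.
by rewrite /cls; congr (\pi_P1%qT _); apply: val_inj; rewrite val_insubd gp.
Qed.

Lemma good_unit_normal (e : Rcomplex R) (k : R) : `|e| = 1 ->
  good (of_complex e (k *: (ii * e))).
Proof.
case: e => a b e1; apply/goodP; rewrite !dual_unitE /=.
case: (eqVneq a 0) => [a0|]; last by left.
right; apply/eqP => b0; move/eqP: e1; rewrite a0 b0.
by rewrite (_ : Complex 0 0 = 0 :> Rcomplex R)// normr0 eq_sym oner_eq0.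
Qed.

Definition dline (p : dvec) : set dvec := [set l *: p | l in [set: dual R]].
Definition perp (p : dvec) : set dvec := [set v | hform v p = 0].

(* D-linear maps D p -> p^perp; the values of [phi] outside D p are
   irrelevant. *)
Definition tangent (p : dvec) (phi : dvec -> dvec) : Prop :=
  (forall v, dline p v -> perp p (phi v)) /\
  (forall (l : dual R) (v w : dvec), dline p v -> dline p w ->
     phi (l *: v + w) = l *: phi v + phi w).

Definition g_P1 (p : dvec) (phi psi : dvec -> dvec) : R :=
  dual_Re (hform (phi p) (psi p) / hform p p).

Definition tangent_curve (p : dvec) (phi : dvec -> dvec) (t : R) : P1 :=
  cls (p + dual_real t *: phi p).

Lemma good_tangent_curve (p : dvec) (phi : dvec -> dvec) (t : R) :
  good p -> tangent p phi -> good (p + dual_real t *: phi p).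
Proof.
move=> /goodP gp [tp _]; apply/goodP.
have /(congr1 fst) /= h : hform (phi p) p = 0.
  by apply: tp; exists 1; rewrite ?scale1r.
move: (phi p) h => q; clear tp.
case: p gp => [[a1 b1] [a2 b2]]; rewrite !dual_unitE /= => gp h.
apply/orP; rewrite -negb_and; apply/negP => /andP[].
move=> /eqP /= w1 /eqP /= w2.
have : a1 ^+ 2 + a2 ^+ 2 == 0.
  have -> : a1 ^+ 2 + a2 ^+ 2 = (a1 + t * q.1.1) * a1 + (a2 + t * q.2.1) * a2
                                - t * (q.1.1 * a1 + q.2.1 * a2) by ring.
  by rewrite w1 w2 h !mul0r mulr0 addr0 subr0.
by rewrite paddr_eq0 ?sqr_ge0// !sqrf_eq0 => /andP[/eqP e1 /eqP e2];
  case: gp; rewrite ?e1 ?e2 eqxx.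
Qed.

End Dual.

Section Smooth.
Variables (R : realType).

(* C^k on an open set, by iterated directional derivatives; on finite
   dimensional spaces, the only ones used below, this is the usual notion. *)
Fixpoint Ck (k : nat) {E F : normedModType R} (U : set E) (f : E -> F) : Prop :=
  (forall x, U x -> {for x, continuous f}) /\
  (if k is k'.+1 then forall v, (forall x, U x -> derivable f x v) /\
                                Ck k' U (fun x => 'D_v f x)
   else True).

Definition smooth_on {E F : normedModType R} (U : set E) (f : E -> F) : Prop :=
  open U /\ forall k, Ck k U f.

(* The smooth structure of the projective line: the inverses
   z |-> [1 : z] and z |-> [z : 1] of the two affine charts, both defined on all
   of D = R^2, with images {u_1 unit} and {u_2 unit} and transition map
   z |-> z^-1 on the units. *)
Definition affine (i : bool) (z : dual R) : P1 R :=
  cls (if i then (z, 1) else (1, z)).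

Lemma affine_inj i : injective (affine i).
Proof.
have ga z : good ((if i then (z, 1) else (1, z)) : dvec R).
  by apply/goodP; case: i; [right|left]; exact: unitr1.
move=> z w /(cls_eqP (ga z) (ga w)) [l _].
case: (i) => e.
  have ew : w = l * z := congr1 (fun p : dvec R => p.1 : dual R) e.
  have el : 1 = l * 1 := congr1 (fun p : dvec R => p.2 : dual R) e.
  by rewrite ew -[l]mulr1 -el mul1r.
have el : 1 = l * 1 := congr1 (fun p : dvec R => p.1 : dual R) e.
have ew : w = l * z := congr1 (fun p : dvec R => p.2 : dual R) e.
by rewrite ew -[l]mulr1 -el mul1r.
Qed.

Lemma affine_cover (P : P1 R) : exists i z, P = affine i z.
Proof.
have [p gp ->] := cls_surj P; move: (gp) => /goodP[] u.
  exists false, ((p.1 : dual R)^-1 * p.2); apply/cls_eqP => //.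
    by apply/goodP; left; exact: unitr1.
  exists (p.1 : dual R)^-1; first by rewrite unitrV.
  by congr pair; rewrite /= ?[RHS]mulVr.
exists true, ((p.2 : dual R)^-1 * p.1); apply/cls_eqP => //.
  by apply/goodP; right; exact: unitr1.
exists (p.2 : dual R)^-1; first by rewrite unitrV.
by congr pair; rewrite /= ?[RHS]mulVr.
Qed.

Definition smooth_from_P1 {E : normedModType R} (f : P1 R -> E) : Prop :=
  forall i, smooth_on setT (f \o affine i).

(* Smoothness on a submanifold [S] of [E]: locally, the map is read in one of
   the charts as the restriction of a smooth map on an open set of [E]. *)
Definition smooth_to_P1 {E : normedModType R} (S : set E) (g : E -> P1 R) :
    Prop :=
  forall x, S x -> exists (U : set E) (i : bool) (h : E -> dual R),
    [/\ U x, smooth_on U h & forall y, S y -> U y -> g y = affine i (h y)].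

Definition diffeomorphism_P1 {E : normedModType R} (S : set E)
    (f : P1 R -> E) : Prop :=
  [/\ forall P, S (f P), smooth_from_P1 f &
      exists g : E -> P1 R, [/\ smooth_to_P1 S g, cancel f g &
                                forall y, S y -> f (g y) = y]].

End Smooth.

Section OrientedLines.
Variable R : realType.
Local Notation C := (Rcomplex R).

Definition circleR : set (C * R) := [set q | `|q.1| = 1].

Definition g_TS1 (u v : C * R) : R := complex.Re (u.1 * conjc v.1).

Definition cline (q : C * R) (t : R) : C := q.2 *: (ii * q.1) + t *: q.1.

(* An oriented line is a line together with an orientation, given as the
   half-line of positive vectors of its direction. *)
Definition oriented_lines : set (set C * set C) :=
  [set L | exists a v : C, [/\ v != 0, L.1 = range (fun t : R => a + t *: v) &
     L.2 = [set t *: v | t in [set t : R | 0 < t]]]].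

(* The image of a curve, with the vectors along which it is traversed. *)
Definition oriented_trace (c : R -> C) : set C * set C :=
  (range c, [set w | exists t t' : R, t < t' /\ w = c t' - c t]).

End OrientedLines.

Arguments circleR R : clear implicits.
Arguments oriented_lines R : clear implicits.

(* Main.v *)
Require Import Defs.
From mathcomp Require Import all_boot all_order all_algebra.
From mathcomp Require Import all_classical all_reals all_analysis.
From mathcomp Require Import complex.
From mathcomp Require Import ring lra.

Import Order.TTheory GRing.Theory Num.Theory.
Import numFieldNormedType.Exports.
Local Open Scope classical_set_scope.
Local Open Scope ring_scope.

(** Write a good vector as p = x + eps y with x, y complex and x nonzero.
    Everything rests on one homogeneous formula for f,
      [p] |-> (x^2 / |x|^2, 2 Im (y conj(x)) / |x|^2)
    ([line_coords]).  Multiplying p by a unit l1 + eps l2 multiplies x by l1 and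
    adds a real multiple of x to l1 y, so the formula is invariant
    ([line_coordsZ]) and descends to the projective line ([line_of]).
    Dividing p by |x| and then removing the component of y along x brings
    every class to the form [e + k eps i e] with |e| = 1 ([cls_normal]), where
    the formula reads (e^2, 2k) ([line_coords_normal]).  A class determines
    this form up to the sign of e, and e^2 determines e up to sign, so f is
    injective ([line_of_inj]).

    In the two affine charts f is rational with denominator 1 + a^2; conversely
    stereographic projection of the circle from -1 or from 1 gives rational
    formulas for a right inverse of f, on two open sets which cover
    ([line_of_affine_chart]).  Rational functions are smooth, so injectivity
    turns f into a diffeomorphism ([line_of_diffeo]).

    Let phi be a tangent vector with phi(p) = u + eps w; orthogonality to p
    says in particular that x . u = 0.  Then |x + t u|^2 is stationary at t = 0,
    hence the circle component of f([p + t phi(p)]) has derivative 2 x u / |x|^2,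
    and Re (2 x u conj(2 x u')) / |x|^4 = 4 (u . u') / |x|^2 is the isometry
    identity ([line_of_isometry]).

    Lines are elementary: the unit direction e is determined by the
    orientation, and s is the component along i e of any point of the line
    ([cline_bij]). *)

(** * Calculus of C^k maps *)

Section IteratedDerivatives.
Context {R : realType}.
Set Implicit Arguments.
Unset Strict Implicit.

Lemma is_derive_linear_comp (E F G : normedModType R) (L : F -> G)
    (f : E -> F) (x v : E) (df : F) :
  linear L -> continuous L -> is_derive x v f df -> is_derive x v (L \o f) (L df).
Proof.
move=> linL cL [/cvg_ex[l fl] ldf].
have L0 : L 0 = 0.
  by have := linL (-1) 0 0; rewrite scaler0 addr0 scaleN1r addNr.
have LB y z : L (y - z) = L y - L z.
  by rewrite (addrC y) -(scaleN1r z) linL scaleN1r addrC.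
have el : l = df by rewrite -ldf; apply/esym/cvg_lim.
have Ll : (fun h => h^-1 *: ((L \o f \o shift x) (h *: v) - (L \o f) x))
    @ 0^' --> L df.
  rewrite -el; have := cvg_comp _ _ fl (cL l).
  rewrite (_ : _ \o _ =
    fun h => h^-1 *: ((L \o f \o shift x) (h *: v) - (L \o f) x))//.
  by apply/funext => h /=; rewrite -[_ *: _]addr0 linL L0 addr0 LB.
by split; [apply/cvg_ex; exists (L df) | exact: cvg_lim Ll].
Qed.

(** The identities [deriveD], [deriveM] and [deriveV] for the derivative of a
    compound map only hold inside the open set; this lemma lets them be used in
    the recursion that defines [Ck]. *)
Lemma Ck_ext k (E F : normedModType R) (U : set E) (f g : E -> F) :
  open U -> {in U, f =1 g} -> Ck k U f -> Ck k U g.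
Proof.
move=> oU; elim: k f g => [|k IH] f g fg [cf Df].
all: have nfg x : U x -> \near x, f x = g x.
1,3: move=> Ux; near=> y; apply/fg/mem_set; near: y; exact: open_nbhs_nbhs.
all: have cg x : U x -> {for x, continuous g}.
1,3: move=> Ux; rewrite /prop_for /continuous_at -(fg x (mem_set Ux)).
1,2: exact: cvg_trans (near_eq_cvg (nfg x Ux)) (cf x Ux).
- by split.
- split=> // v; have [df Cf] := Df v; split=> [x Ux|].
    exact: near_eq_derivable (nfg x Ux) (df x Ux).
  by apply: IH Cf => x /set_mem Ux; exact: near_eq_derive (nfg x Ux).
Unshelve. all: by end_near. Qed.

Lemma CkW k (E F : normedModType R) (U : set E) (f : E -> F) :
  Ck k.+1 U f -> Ck k U f.
Proof.
elim: k f => [|k IH] f [cf Df]; split=> // v.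
by have [df /IH] := Df v.
Qed.

Lemma Ck_cst k (E F : normedModType R) (U : set E) (a : F) :
  Ck k U (fun=> a : F).
Proof.
elim: k a => [|k IH] a; split=> //; try by move=> x _; exact: cvg_cst.
move=> v; split=> [x _|]; first exact: derivable_cst.
by under eq_fun do rewrite derive_cst.
Qed.

Lemma Ck_id k (E : normedModType R) (U : set E) : Ck k U (id : E -> E).
Proof.
case: k => [|k]; split=> //; try by move=> x _; exact: cvg_id.
move=> v; split=> [x _|]; first exact: derivable_id.
by under eq_fun do rewrite derive_id; exact: Ck_cst.
Qed.

Lemma Ck_linear_comp k (E F G : normedModType R) (L : F -> G)
    (U : set E) (f : E -> F) :
  open U -> linear L -> continuous L -> Ck k U f -> Ck k U (L \o f).
Proof.
move=> oU linL cL; elim: k f => [|k IH] f [cf Df].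
all: split; first by move=> x Ux; apply: continuous_comp; [exact: cf|exact: cL].
  by [].
move=> v; have [df Cf] := Df v.
have D x : U x -> is_derive x v (L \o f) (L ('D_v f x)).
  by move=> Ux; apply: is_derive_linear_comp => //; exact/derivableP/df.
split=> [x Ux|]; first by have [] := D x Ux.
apply: Ck_ext (IH _ Cf) => // x /set_mem Ux.
by have [_] := D x Ux; exact: esym.
Qed.

Lemma Ck_linear k (E F : normedModType R) (L : E -> F) (U : set E) :
  open U -> linear L -> continuous L -> Ck k U L.
Proof. by move=> oU linL cL; exact: Ck_linear_comp (Ck_id k U). Qed.

Lemma CkN k (E F : normedModType R) (U : set E) (f : E -> F) :
  open U -> Ck k U f -> Ck k U (fun x => - f x).
Proof.
move=> oU Cf.
apply: (Ck_linear_comp (L := -%R)) Cf => //; last exact: opp_continuous.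
exact: linearP.
Qed.

Lemma CkZl k (E F : normedModType R) (U : set E) (f : E -> R) (w : F) :
  open U -> Ck k U f -> Ck k U (fun x => f x *: w).
Proof.
move=> oU Cf; apply: (@Ck_linear_comp k E R^o F ( *:%R^~ w)) Cf => //.
  by move=> a u v; rewrite scalerDl scalerA.
exact: scalel_continuous.
Qed.

Lemma CkD k (E F : normedModType R) (U : set E) (f g : E -> F) :
  open U -> Ck k U f -> Ck k U g -> Ck k U (fun x => f x + g x).
Proof.
move=> oU; elim: k f g => [|k IH] f g [cf Df] [cg Dg].
all: split; first by move=> x Ux; apply: cvgD; [exact: cf|exact: cg].
  by [].
move=> v; have [df Cf] := Df v; have [dg Cg] := Dg v.
split=> [x Ux|]; first exact: derivableD (df x Ux) (dg x Ux).
apply: Ck_ext (IH _ _ Cf Cg) => // x /set_mem Ux.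
by rewrite -deriveD//; [exact: df|exact: dg].
Qed.

Lemma CkM k (E : normedModType R) (U : set E) (f g : E -> R) :
  open U -> Ck k U f -> Ck k U g -> Ck k U (fun x => f x * g x).
Proof.
move=> oU; elim: k f g => [|k IH] f g Cf Cg.
all: have [cf Df] := Cf; have [cg Dg] := Cg.
all: split; first by move=> x Ux; apply: cvgM; [exact: cf|exact: cg].
  by [].
move=> v; have [df Cdf] := Df v; have [dg Cdg] := Dg v.
split=> [x Ux|]; first exact: derivableM (df x Ux) (dg x Ux).
apply: Ck_ext (CkD oU (IH _ _ (CkW Cf) Cdg) (IH _ _ (CkW Cg) Cdf)) => //.
move=> x /set_mem Ux.
by rewrite [RHS]deriveM//; [exact: df|exact: dg].
Qed.

Lemma CkV k (E : normedModType R) (U : set E) (f : E -> R) :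
  open U -> (forall x, U x -> f x != 0) -> Ck k U f ->
  Ck k U (fun x => (f x)^-1).
Proof.
move=> oU f0; elim: k => [|k IH] Cf; have [cf Df] := Cf.
all: split; first by move=> x Ux; apply: cvgV; [exact: f0|exact: cf].
  by [].
move=> v; have [df Cdf] := Df v.
split=> [x Ux|]; first exact: derivableV (f0 x Ux) (df x Ux).
(* the derivative of 1/f is again a product of 1/f, 1/f and a derivative of f *)
have Cv := IH (CkW Cf).
apply: Ck_ext (CkN oU (CkM oU (CkM oU Cv Cv) Cdf)) => //.
move=> x /set_mem Ux.
by rewrite deriveV//; [rewrite -exprVn expr2 -mulNr|exact: f0|exact: df].
Qed.

Lemma linear_contraction_continuous (E F : normedModType R) (L : E -> F) :
  linear L -> (forall x, `|L x| <= `|x|) -> continuous L.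
Proof.
move=> linL leL x; apply/cvgrPdist_le => e e0; near=> y.
have -> : L x - L y = L (x - y).
  by rewrite (addrC x) -(scaleN1r y) linL scaleN1r addrC.
apply: le_trans (leL _) _; near: y.
by apply: cvgr_dist_le => //; exact: cvg_id.
Unshelve. all: by end_near. Qed.

End IteratedDerivatives.

(** * Real coordinates on C, on C x R and on the dual numbers *)

Section RealCoordinates.
Context {R : realType}.
Set Implicit Arguments.
Unset Strict Implicit.
Local Notation C := (Rcomplex R).

Lemma Rcomplex_norm (z : C) :
  `|z| = Num.sqrt (complex.Re z ^+ 2 + complex.Im z ^+ 2).
Proof. by case: z. Qed.

Lemma Rcomplex_norm1 (z : C) :
  (`|z| = 1) <-> (complex.Re z ^+ 2 + complex.Im z ^+ 2 = 1).
Proof.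
rewrite Rcomplex_norm; split=> [h|->]; last exact: sqrtr1.
by rewrite -[LHS]sqr_sqrtr ?h ?expr1n// addr_ge0// sqr_ge0.
Qed.

Lemma Rcomplex_sqr (a b : R) :
  (Complex a b : C) ^+ 2 = Complex (a ^+ 2 - b ^+ 2) (2 * a * b).
Proof. by rewrite expr2; congr Complex; ring. Qed.

Lemma normRe_le (z : C) : `|complex.Re z| <= `|z|.
Proof. by rewrite Rcomplex_norm -sqrtr_sqr ler_wsqrtr// lerDl sqr_ge0. Qed.

Lemma normIm_le (z : C) : `|complex.Im z| <= `|z|.
Proof. by rewrite Rcomplex_norm -sqrtr_sqr ler_wsqrtr// lerDr sqr_ge0. Qed.

Lemma Re_fst_linear : linear (fun q : C * R => complex.Re q.1).
Proof. by move=> a [[? ?] ?] [[? ?] ?]. Qed.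

Lemma Re_fst_continuous : continuous (fun q : C * R => complex.Re q.1 : R).
Proof.
apply: (linear_contraction_continuous Re_fst_linear) => q.
by apply: le_trans (normRe_le _) _; rewrite [leRHS]prod_normE le_max lexx.
Qed.

Lemma Im_fst_linear : linear (fun q : C * R => complex.Im q.1).
Proof. by move=> a [[? ?] ?] [[? ?] ?]. Qed.

Lemma Im_fst_continuous : continuous (fun q : C * R => complex.Im q.1 : R).
Proof.
apply: (linear_contraction_continuous Im_fst_linear) => q.
by apply: le_trans (normIm_le _) _; rewrite [leRHS]prod_normE le_max lexx.
Qed.

Lemma Ck_fst k (E F : normedModType R) (U : set (E * F)) :
  open U -> Ck k U (fun q : E * F => q.1).
Proof.
move=> oU; have lin : linear (fst : E * F -> E) by [].
apply: Ck_linear => //; apply: linear_contraction_continuous => // q.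
by rewrite [leRHS]prod_normE le_max lexx.
Qed.

Lemma Ck_snd k (E F : normedModType R) (U : set (E * F)) :
  open U -> Ck k U (fun q : E * F => q.2).
Proof.
move=> oU; have lin : linear (snd : E * F -> F) by [].
apply: Ck_linear => //; apply: linear_contraction_continuous => // q.
by rewrite [leRHS]prod_normE le_max lexx orbT.
Qed.

(** Smoothness and derivatives of a map into C x R reduce through this
    decomposition to those of its three real coordinates. *)
Lemma plane_line_basis (c s r : R) :
  (Complex c s : C, r) =
  c *: (1 : C, 0 : R) + s *: (ii : C, 0 : R) + r *: (0 : C, 1 : R).
Proof.
rewrite [RHS]surjective_pairing /=; congr pair; first by congr Complex; ring.
by rewrite !scaler0 !add0r [RHS]mulr1.
Qed.

Lemma Ck_plane_line k (E : normedModType R) (U : set E) (c s r : E -> R) :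
  open U -> Ck k U c -> Ck k U s -> Ck k U r ->
  Ck k U (fun x => (Complex (c x) (s x) : C, r x)).
Proof.
move=> oU Cc Cs Cr; under eq_fun do rewrite plane_line_basis.
by apply: CkD => //; [apply: CkD => //|]; exact: CkZl.
Qed.

Lemma is_derive_plane_line (c s r : R -> R) (t dc ds dr : R) :
  is_derive t 1 c dc -> is_derive t 1 s ds -> is_derive t 1 r dr ->
  is_derive t (1 : R) (fun x => (Complex (c x) (s x) : C, r x))
    (Complex dc ds : C, dr).
Proof.
move=> Dc Ds Dr; under eq_fun do rewrite plane_line_basis.
rewrite plane_line_basis.
have DZ (f : R -> R) (df : R) (w : C * R) : is_derive t (1 : R) f df ->
    is_derive t 1 (fun x => f x *: w) (df *: w).
  apply: (@is_derive_linear_comp R R^o R^o _ ( *:%R^~ w)).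
    by move=> a u v; rewrite scalerDl scalerA.
  exact: scalel_continuous.
exact: is_deriveD (is_deriveD (DZ _ _ _ Dc) (DZ _ _ _ Ds)) (DZ _ _ _ Dr).
Qed.

Lemma Ck_dual k (E : normedModType R) (U : set E) (a b : E -> R) :
  open U -> Ck k U a -> Ck k U b -> Ck k U (fun x => (a x, b x) : dual R).
Proof.
move=> oU Ca Cb.
have -> : (fun x => (a x, b x) : dual R) =
    fun x => a x *: ((1, 0) : dual R) + b x *: ((0, 1) : dual R).
  apply/funext => x; rewrite [RHS]surjective_pairing /=.
  by rewrite !scaler0 addr0 add0r; congr pair; rewrite [RHS]mulr1.
by apply: CkD => //; exact: CkZl.
Qed.

End RealCoordinates.

(** * The circle times the line parametrizes oriented lines *)

Section OrientedLines.
Context {R : realType}.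
Set Implicit Arguments.
Unset Strict Implicit.
Local Notation C := (Rcomplex R).

Lemma oriented_trace_cline (q : C * R) :
  oriented_trace (cline q) =
  (range (cline q), [set t *: q.1 | t in [set t : R | 0 < t]]).
Proof.
congr pair; apply/seteqP; split=> w.
- case=> t [t' [tt' ->]]; exists (t' - t); first by rewrite /= subr_gt0.
  by rewrite /cline opprD addrACA subrr add0r scalerBl.
- case=> t /= t0 <-; exists 0, t; split=> //.
  by rewrite /cline scale0r addr0 addrC addKr.
Qed.

Lemma cline_inj :
  {in circleR R &, injective (fun q => oriented_trace (cline q))}.
Proof.
move=> [e s] [e' s'] /set_mem/= e1 /set_mem/= e1'.
rewrite !oriented_trace_cline => -[lines directions].
have ee : e = e'.
  have : [set t *: e | t in [set t : R | 0 < t]] e.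
    by exists 1; rewrite ?scale1r /=.
  rewrite directions => -[t /= t0] te.
  suff t1 : t = 1 by rewrite -te t1 scale1r.
  by have := congr1 Num.norm te; rewrite normrZ e1 e1' mulr1 gtr0_norm.
subst e'; congr pair.
have : range (cline (e, s)) (cline (e, s) 0) by exists 0.
rewrite lines => -[t _].
move: e1 => /Rcomplex_norm1; case: (e) => a b /= ab1.
have a2 : a ^+ 2 = 1 - b ^+ 2 by rewrite -ab1 addrK.
rewrite /cline /= => -[ha hb].
(* inner product with i e = (-b, a) of the equality (ha, hb) of two points *)
have hs : s' = s
    + ((s' * (0 * a - 1 * b) + t * a) - (s * (0 * a - 1 * b) + 0 * a)) * - b
    + ((s' * (0 * b + 1 * a) + t * b) - (s * (0 * b + 1 * a) + 0 * b)) * a.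
  by ring: a2.
by rewrite hs ha hb !subrr !mul0r !addr0.
Qed.

Lemma cline_surj :
  set_surj (circleR R) (oriented_lines R) (fun q => oriented_trace (cline q)).
Proof.
move=> [L D] [a [v [v0 /= -> ->]]].
have r0 : 0 < `|v| by rewrite normr_gt0.
pose e : C := `|v|^-1 *: v.
have e1 : `|e| = 1 by rewrite normrZ gtr0_norm ?invr_gt0// mulVf ?gt_eqF.
have ve : v = `|v| *: e by rewrite scalerA divff ?gt_eqF// scale1r.
(* s and m are the coordinates of the point a in the orthonormal basis i e, e *)
clearbody e; pose s : R :=
  complex.Im a * complex.Re e - complex.Re a * complex.Im e.
pose m : R := complex.Re a * complex.Re e + complex.Im a * complex.Im e.
have am : a = s *: (ii * e) + m *: e.
  move: e1 => /Rcomplex_norm1; rewrite /s /m; case: (e) => x y /= xy1.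
  have x2 : x ^+ 2 = 1 - y ^+ 2 by rewrite -xy1 addrK.
  by case: (a) => b c; congr Complex => /=; ring: x2.
clearbody s m.
exists (e, s) => //; rewrite oriented_trace_cline /=.
congr pair; apply/seteqP; split=> w.
- case=> t _ <-; exists ((t - m) / `|v|) => //.
  rewrite {2}ve scalerA divfK ?gt_eqF// {1}am /cline /=.
  by rewrite -addrA -scalerDl (addrC m) subrK.
- case=> t _ <-; exists (m + t * `|v|) => //.
  by rewrite {2}ve scalerA {1}am /cline /= scalerDl addrA.
- case=> t /= t0 <-; exists (t / `|v|); first by rewrite /= divr_gt0.
  by rewrite {2}ve scalerA divfK ?gt_eqF.
- case=> t /= t0 <-; exists (t * `|v|); first by rewrite /= mulr_gt0.
  by rewrite [in RHS]ve scalerA.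
Qed.

Lemma cline_bij :
  set_bij (circleR R) (oriented_lines R) (fun q => oriented_trace (cline q)).
Proof.
split; [|exact: cline_inj|exact: cline_surj].
move=> [e s] /= e1; exists (s *: (ii * e)), e.
rewrite oriented_trace_cline; split=> //.
by rewrite -normr_eq0 e1 oner_eq0.
Qed.

End OrientedLines.

(** * The bijection between the projective line and the circle times the line *)

Section LineOf.
Context {R : realType}.
Set Implicit Arguments.
Unset Strict Implicit.
Local Notation C := (Rcomplex R).

(** The real number <p, p>, i.e. |x|^2 for p = x + eps y. *)
Definition sqnorm (p : dvec R) : R := p.1.1 ^+ 2 + p.2.1 ^+ 2.

Lemma good_sqnorm (p : dvec R) : good p <-> 0 < sqnorm p.
Proof.
have N0 : 0 <= sqnorm p by rewrite addr_ge0// sqr_ge0.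
rewrite lt0r N0 andbT paddr_eq0 ?sqr_ge0// !sqrf_eq0 negb_and.
by rewrite goodP !dual_unitE; split=> /orP.
Qed.

(** For p = x + eps y this is (x^2 / |x|^2, 2 Im (y conj(x)) / |x|^2). *)
Definition line_coords (p : dvec R) : C * R :=
  (Complex ((p.1.1 ^+ 2 - p.2.1 ^+ 2) / sqnorm p)
           (2 * p.1.1 * p.2.1 / sqnorm p),
   2 * (p.1.1 * p.2.2 - p.2.1 * p.1.2) / sqnorm p).

Lemma line_coords_circle (p : dvec R) : good p -> circleR R (line_coords p).
Proof.
move=> /good_sqnorm/lt0r_neq0 N0; apply/Rcomplex_norm1 => /=.
by rewrite /sqnorm in N0 *; field.
Qed.

Lemma line_coordsZ (l : dual R) (p : dvec R) : good p -> l \is a GRing.unit ->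
  line_coords (l *: p) = line_coords p.
Proof.
move=> /good_sqnorm/lt0r_neq0; case: p l => [[x1 y1] [x2 y2]] [l1 l2].
rewrite dual_unitE /line_coords /sqnorm /= => N0 l0.
have M0 : (l1 * x1) ^+ 2 + (l1 * x2) ^+ 2 != 0.
  by rewrite !exprMn -mulrDr mulf_neq0// expf_neq0.
by congr (Complex _ _, _); field; rewrite N0 M0.
Qed.

Lemma line_coords_normal (e : C) (k : R) : `|e| = 1 ->
  line_coords (of_complex e (k *: (ii * e))) = (e ^+ 2, 2 * k).
Proof.
move=> /Rcomplex_norm1; case: e => a b /= ab1.
rewrite /line_coords /sqnorm /= ab1 !divr1 Rcomplex_sqr.
congr pair.
have a2 : a ^+ 2 = 1 - b ^+ 2 by rewrite -ab1 addrK.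
by ring: a2.
Qed.

Lemma cls_normal (p : dvec R) : good p ->
  exists e k, `|e| = 1 /\ cls p = cls (of_complex e (k *: (ii * e))).
Proof.
move=> gp; have := gp; rewrite good_sqnorm.
case: p gp => [[x1 y1] [x2 y2]] gp; rewrite /sqnorm /= => N0.
set r := Num.sqrt (x1 ^+ 2 + x2 ^+ 2).
have r0 : r != 0 by rewrite sqrtr_eq0 -ltNge.
have r2 : r ^+ 2 = x1 ^+ 2 + x2 ^+ 2 by rewrite sqr_sqrtr// ltW.
have e1 : `|(Complex (x1 / r) (x2 / r) : C)| = 1.
  apply/Rcomplex_norm1.
  by rewrite /= !exprMn -mulrDl -r2 exprVn divff ?expf_neq0.
exists (Complex (x1 / r) (x2 / r)), ((x1 * y2 - x2 * y1) / r ^+ 2); split=> //.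
apply/cls_eqP => //; first exact: good_unit_normal.
(* the unit (1/|x|) (1 - eps (x . y) / |x|^2): the second factor removes the
   component of y along x *)
exists (r^-1, - (x1 * y1 + x2 * y2) / r ^+ 3).
  by rewrite dual_unitE /= invr_neq0.
have x1E : x1 ^+ 2 = r ^+ 2 - x2 ^+ 2 by rewrite r2 addrK.
congr pair; congr pair; rewrite /=.
- by rewrite mulrC.
- by field: x1E.
- by rewrite mulrC.
- by field: x1E.
Qed.

Lemma cls_normal_inj (e e' : C) (k : R) : `|e| = 1 -> `|e'| = 1 ->
  e ^+ 2 = e' ^+ 2 ->
  cls (of_complex e (k *: (ii * e))) = cls (of_complex e' (k *: (ii * e'))).
Proof.
move=> e1 e1' /eqP; rewrite eqf_sqr => /orP[/eqP ->//|/eqP ee].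
apply/cls_eqP; [exact: good_unit_normal|exact: good_unit_normal|].
exists (-1); first by rewrite unitrN1.
rewrite ee scaleN1r; case: (e') => a b.
by congr pair; congr pair; rewrite /=; ring.
Qed.

(** The map f; by [line_coordsZ] the choice of a representative is harmless. *)
Definition line_of (P : P1 R) : C * R :=
  line_coords (s2val (cid2 (cls_surj P))).

Lemma line_of_cls (p : dvec R) : good p -> line_of (cls p) = line_coords p.
Proof.
move=> gp; rewrite /line_of; case: cid2 => q /= gq /(cls_eqP gp gq)[l ul ->].
exact: line_coordsZ.
Qed.

Lemma line_of_normal (e : C) (k : R) : `|e| = 1 ->
  line_of (cls (of_complex e (k *: (ii * e)))) = (e ^+ 2, 2 * k).
Proof.
move=> e1; rewrite line_of_cls; first exact: line_coords_normal.
exact: good_unit_normal.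
Qed.

Lemma line_of_circle (P : P1 R) : circleR R (line_of P).
Proof.
have [p gp ->] := cls_surj P.
by rewrite line_of_cls//; exact: line_coords_circle.
Qed.

Lemma P1_normal (P : P1 R) : exists (e : C) (k : R),
  `|e| = 1 /\ P = cls (of_complex e (k *: (ii * e))).
Proof. by have [p gp ->] := cls_surj P; exact: cls_normal. Qed.

Lemma line_of_inj : injective line_of.
Proof.
move=> P Q; have [e [k [e1 ->]]] := P1_normal P.
have [e' [k' [e1' ->]]] := P1_normal Q.
rewrite !line_of_normal// => -[ee kk].
have -> : k' = k by apply: (mulfI (_ : 2 != 0 :> R)) => //; rewrite pnatr_eq0.
exact: cls_normal_inj.
Qed.

(** * The bijection is a diffeomorphism *)

(** Exchanging the points [1 : z] and [z : 1] changes the sign of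
    the real part of x^2 and of Im (y conj(x)); this sign allows both charts to
    share their formulas. *)
Definition chart_sign (i : bool) : R := if i then -1 else 1.

Definition chart_domain (i : bool) : set (C * R) :=
  [set q | 0 < 1 + chart_sign i * complex.Re q.1].

(** The first coordinate is the stereographic projection of the circle from
    the point - chart_sign i. *)
Definition chart (i : bool) (q : C * R) : dual R :=
  (complex.Im q.1 / (1 + chart_sign i * complex.Re q.1),
   chart_sign i * q.2 / (1 + chart_sign i * complex.Re q.1)).

Lemma line_of_affine (i : bool) (z : dual R) :
  line_of (affine i z) =
  (Complex (chart_sign i * ((1 - z.1 * z.1) * (1 + z.1 * z.1)^-1))
           (2 * (z.1 * (1 + z.1 * z.1)^-1)),
   chart_sign i * 2 * (z.2 * (1 + z.1 * z.1)^-1)).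
Proof.
rewrite line_of_cls; last first.
  by apply/goodP; case: i; [right|left]; exact: unitr1.
have z0 : 1 + z.1 ^+ 2 != 0 by rewrite gt_eqF// ltr_pwDl// sqr_ge0.
have z0' : z.1 ^+ 2 + 1 != 0 by rewrite addrC.
rewrite /line_coords /sqnorm /chart_sign -!expr2.
case: i => /=; rewrite expr1n.
all: by congr (Complex _ _, _); field; rewrite ?z0 ?z0'.
Qed.

Lemma line_of_affine_chart (i : bool) (q : C * R) :
  circleR R q -> chart_domain i q -> line_of (affine i (chart i q)) = q.
Proof.
case: q => [[c s] r] /Rcomplex_norm1/= cs1; rewrite /chart_domain/= => d0.
have s2 : s ^+ 2 = 1 - c ^+ 2 by rewrite -cs1 addrC addKr.
have d0' := lt0r_neq0 d0.
rewrite line_of_affine /chart /=.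
set d := 1 + chart_sign i * c in d0 d0' *.
have sg2 : chart_sign i ^+ 2 = 1.
  by rewrite /chart_sign; case: i {d d0 d0'}; rewrite ?sqrrN expr1n.
have e1 : 1 + s / d * (s / d) = 2 / d.
  apply: (mulIf (expf_neq0 2 d0')).
  by rewrite /d in d0' *; field: sg2 s2.
rewrite e1 invf_div.
congr (Complex _ _, _).
- by rewrite /d in d0' *; field: sg2 s2.
- by field.
- by field: sg2.
Qed.

Lemma chart_domain_cover (q : C * R) : exists i, chart_domain i q.
Proof.
rewrite /chart_domain/chart_sign /=.
have [c0|c0] := leP 0 (complex.Re q.1); first by exists false; lra.
by exists true; lra.
Qed.

Lemma chart_domain_open (i : bool) : open (chart_domain i).
Proof.
rewrite (_ : chart_domain i =
  (fun q : C * R => 1 + chart_sign i * complex.Re q.1) @^-1` [set x | 0 < x])//.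
apply: open_comp; last exact: open_gt.
move=> q _; apply: cvgD; first exact: cvg_cst.
by apply: cvgM; [exact: cvg_cst|exact: Re_fst_continuous].
Qed.

Lemma chart_smooth (i : bool) : smooth_on (chart_domain i) (chart i).
Proof.
have oU := @chart_domain_open i; split=> // k.
have CRe := Ck_linear k oU (@Re_fst_linear R) (@Re_fst_continuous R).
have CIm := Ck_linear k oU (@Im_fst_linear R) (@Im_fst_continuous R).
have CV : Ck k (chart_domain i)
    (fun q => (1 + chart_sign i * complex.Re q.1)^-1).
  apply: CkV => // [q /lt0r_neq0 //|].
  apply: CkD => //; first exact: Ck_cst.
  by apply: CkM => //; exact: Ck_cst.
apply: Ck_dual => //; apply: CkM => //.
by apply: CkM => //; [exact: Ck_cst|exact: (@Ck_snd R k C R^o)].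
Qed.

Lemma line_of_smooth : smooth_from_P1 line_of.
Proof.
move=> i; split=> [|k]; first exact: openT.
have oT := @openT (dual R).
apply: (Ck_ext oT (fun z _ => esym (line_of_affine i z))).
have Ca : Ck k setT (fun z : dual R => z.1) := @Ck_fst R k R^o R^o _ oT.
have Cb : Ck k setT (fun z : dual R => z.2) := @Ck_snd R k R^o R^o _ oT.
have Caa := CkM oT Ca Ca.
have CV : Ck k setT (fun z : dual R => (1 + z.1 * z.1)^-1).
  apply: CkV => // [z _|]; last by apply: CkD => //; exact: Ck_cst.
  by rewrite gt_eqF// ltr_pwDl// -expr2 sqr_ge0.
apply: Ck_plane_line => //.
- apply: CkM => //; first exact: Ck_cst.
  by apply: CkM => //; apply: CkD => //; [exact: Ck_cst|exact: CkN].
- by apply: CkM => //; [exact: Ck_cst|exact: CkM].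
- by apply: CkM => //; [exact: Ck_cst|exact: CkM].
Qed.

(** The inverse picks, at each point, one of the charts whose domain contains
    it.  As f is injective, the choice does not matter: on the whole of either
    domain the inverse is given by that chart, which makes it smooth. *)
Lemma line_of_diffeo : diffeomorphism_P1 (circleR R) line_of.
Proof.
split; [exact: line_of_circle|exact: line_of_smooth|].
pose g q := let i := projT1 (cid (chart_domain_cover q)) in
  affine i (chart i q).
have gK q : circleR R q -> line_of (g q) = q.
  by move=> qS; rewrite /g; case: cid => i /= iq; exact: line_of_affine_chart.
exists g; split=> //.
- move=> q qS; have [i iq] := chart_domain_cover q.
  exists (chart_domain i), i, (chart i); split=> // [|q' q'S iq'].
    exact: chart_smooth.
  by apply: line_of_inj; rewrite gK// line_of_affine_chart.
- by move=> P; apply: line_of_inj; rewrite gK//; exact: line_of_circle.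
Qed.

(** * The bijection is an isometry up to the factor 4 *)

Lemma is_derive_quadratic (a0 a1 a2 : R) :
  is_derive (0 : R) 1 (fun t : R => a0 + t * a1 + t * t * a2) a1.
Proof.
have : is_derive (0 : R) 1 (cst a0 + id * cst a1 + id * id * cst a2 : R -> R) a1.
  apply: is_derive_eq; rewrite /= /cst !scaler0 !scale0r !add0r.
  by rewrite scaler0 addr0 [LHS]mulr1.
by [].
Qed.

(** The denominator is stationary at 0, so only the numerator contributes. *)
Lemma is_derive_quotient (a0 a1 a2 b0 b2 : R) : b0 != 0 ->
  is_derive (0 : R) 1
    (fun t : R => (a0 + t * a1 + t * t * a2) / (b0 + t * 0 + t * t * b2))
    (a1 / b0).
Proof.
move=> b00.
have [dA A'] := is_derive_quadratic a0 a1 a2.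
have [dB B'] := is_derive_quadratic b0 0 b2.
set B := fun t => _ + _ in dB B'; set A := fun t => _ + _ in dA A'.
have B0 : B 0 = b0 by rewrite /B !mul0r !addr0.
have B0' : B 0 != 0 by rewrite B0.
have dV := derivableV B0' dB.
split; first exact: derivableM dA dV.
rewrite [LHS](deriveM dA dV) deriveV// A' B' scaler0 scaler0 add0r B0.
exact: mulrC.
Qed.

Lemma is_derive_line_coords (p q : dvec R) : good p -> (hform q p).1 = 0 ->
  is_derive (0 : R) 1 (fun t : R => line_coords (p + dual_real t *: q))
    (Complex (2 * (p.1.1 * q.1.1 - p.2.1 * q.2.1) / sqnorm p)
             (2 * (p.1.1 * q.2.1 + p.2.1 * q.1.1) / sqnorm p) : C,
     2 * (q.1.1 * p.2.2 + p.1.1 * q.2.2 - q.2.1 * p.1.2 - p.2.1 * q.1.2)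
       / sqnorm p).
Proof.
move=> /good_sqnorm/lt0r_neq0.
case: p q => [[x1 y1] [x2 y2]] [[u1 w1] [u2 w2]]; rewrite /sqnorm /= => N0 h.
have ux : u1 * x1 = - (u2 * x2) by apply/eqP; rewrite -addr_eq0 h.
pose D t := (x1 ^+ 2 + x2 ^+ 2) + t * 0 + t * t * (u1 ^+ 2 + u2 ^+ 2).
have ND t : (x1 + t * u1) ^+ 2 + (x2 + t * u2) ^+ 2 = D t.
  by rewrite /D; ring: ux.
have -> : (fun t : R => line_coords ((((x1, y1), (x2, y2)) : dvec R) +
      dual_real t *: (((u1, w1), (u2, w2)) : dvec R))) =
  fun t => (Complex
    (((x1 ^+ 2 - x2 ^+ 2) + t * (2 * (x1 * u1 - x2 * u2))
      + t * t * (u1 ^+ 2 - u2 ^+ 2)) / D t)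
    ((2 * x1 * x2 + t * (2 * (x1 * u2 + x2 * u1))
      + t * t * (2 * u1 * u2)) / D t) : C,
    (2 * (x1 * y2 - x2 * y1) + t * (2 * (u1 * y2 + x1 * w2 - u2 * y1 - x2 * w1))
      + t * t * (2 * (u1 * w2 - u2 * w1))) / D t).
  apply/funext => t; rewrite /line_coords /sqnorm /= ND.
  by congr (Complex (_ / _) (_ / _), _ / _); ring.
by apply: is_derive_plane_line; exact: is_derive_quotient.
Qed.

Lemma is_derive_line_of (p : dvec R) (phi : dvec R -> dvec R) :
  good p -> tangent p phi ->
  is_derive (0 : R) 1 (line_of \o tangent_curve p phi)
   (Complex (2 * (p.1.1 * (phi p).1.1 - p.2.1 * (phi p).2.1) / sqnorm p)
            (2 * (p.1.1 * (phi p).2.1 + p.2.1 * (phi p).1.1) / sqnorm p) : C,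
    2 * ((phi p).1.1 * p.2.2 + p.1.1 * (phi p).2.2
         - (phi p).2.1 * p.1.2 - p.2.1 * (phi p).1.2) / sqnorm p).
Proof.
move=> gp tp.
have -> : line_of \o tangent_curve p phi =
    fun t : R => line_coords (p + dual_real t *: phi p).
  by apply/funext => t; rewrite /= line_of_cls//; exact: good_tangent_curve.
apply: is_derive_line_coords => //.
have [orth _] := tp.
by have -> : hform (phi p) p = 0 by apply: orth; exists 1; rewrite ?scale1r.
Qed.

Lemma dual_ReE (u : dual R) : dual_Re u = u.1.
Proof. by have: 2^-1 * (u.1 + u.1) = u.1 by field. Qed.

Lemma g_P1E (p : dvec R) (phi psi : dvec R -> dvec R) : good p ->
  g_P1 p phi psi =
  ((phi p).1.1 * (psi p).1.1 + (phi p).2.1 * (psi p).2.1) / sqnorm p.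
Proof.
move=> /good_sqnorm/lt0r_neq0 N0.
have u : dual_unit (hform p p) by rewrite /dual_unit /= -!expr2.
rewrite /g_P1 dual_ReE /=.
by rewrite [_^-1]/(dual_inv _) /dual_inv u /= -!expr2.
Qed.

Lemma line_of_isometry (p : dvec R) (phi psi : dvec R -> dvec R) :
  good p -> tangent p phi -> tangent p psi ->
  [/\ derivable (line_of \o tangent_curve p phi) 0 1,
      derivable (line_of \o tangent_curve p psi) 0 1 &
      g_TS1 ('D_1 (line_of \o tangent_curve p phi) 0)
            ('D_1 (line_of \o tangent_curve p psi) 0)
      = 4 * g_P1 p phi psi].
Proof.
move=> gp tphi tpsi.
have [dphi ->] := is_derive_line_of gp tphi.
have [dpsi ->] := is_derive_line_of gp tpsi.
split; [exact: dphi|exact: dpsi|].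
rewrite (g_P1E phi psi gp) /g_TS1 /=.
have /lt0r_neq0 := (good_sqnorm p).1 gp; rewrite /sqnorm => N0.
by field.
Qed.

End LineOf.

Theorem mainTheorem1 (R : realType) :
  set_bij (circleR R) (oriented_lines R) (fun q => oriented_trace (cline q)) /\
  (forall P : P1 R, exists (e : Rcomplex R) (k : R),
     `|e| = 1 /\ P = cls (of_complex e (k *: (ii * e)))) /\
  exists f : P1 R -> Rcomplex R * R,
    [/\ forall (e : Rcomplex R) (k : R), `|e| = 1 ->
          f (cls (of_complex e (k *: (ii * e)))) = (e ^+ 2, 2 * k),
        diffeomorphism_P1 (circleR R) f,
        forall (p : dvec R) (phi psi : dvec R -> dvec R),
          good p -> tangent p phi -> tangent p psi ->
          [/\ derivable (f \o tangent_curve p phi) 0 1,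
              derivable (f \o tangent_curve p psi) 0 1 &
              g_TS1 ('D_1 (f \o tangent_curve p phi) 0)
                    ('D_1 (f \o tangent_curve p psi) 0)
              = 4 * g_P1 p phi psi] &
        set_bij setT (oriented_lines R)
          (fun P => oriented_trace (cline (f P)))].
Proof.
split; first exact: cline_bij.
split; first exact: P1_normal.
exists line_of; split.
- exact: line_of_normal.
- exact: line_of_diffeo.
- exact: line_of_isometry.
- have [_ _ [g [_ _ gK]]] := @line_of_diffeo R.
  have [lines_fun lines_inj lines_surj] := @cline_bij R.
  split.
  + by move=> P _; apply: lines_fun; exact: line_of_circle.
  + move=> P Q _ _ PQ; apply: line_of_inj.
    by apply: lines_inj PQ; apply/mem_set; exact: line_of_circle.
  + move=> L /lines_surj[q qS <-]; exists (g q) => //.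
    by rewrite gK.
Qed.
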